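(* Let $k\geq 3$. A nonempty word $A$ is such that $AA$ is a factor of $W^{(k)}$ if and only if $A\in\{ki\oplus C^{j}(W^{(k)}_{n-2k+1}) : n\geq 2k-1,\ 0\leq j\leq |V^{(k)}_n|,\ i>0\}$.
   Context: Fix an integer $k\geq 3$. Words are over $\mathbb{N}$ (letters called digits). Define the morphism $\varphi_k$ on $\mathbb{N}$ by $\varphi_k(ki+j)=(ki)(ki+j+1)$ if $0\le j\le k-2$, and $\varphi_k(ki+j)=(ki+j+1)$ if $j=k-1$. Let $W^{(k)}_n=\varphi_k^n(0)$ for $n\ge 0$ and let $W^{(k)}=\varphi_k^{\omega}(0)$ be the infinite fixed point. For a word $U$ and integer $m$, $m\oplus U$ adds $m$ to every digit of $U$. For a finite word $U=u_1\cdots u_p$ and $0\le j\le p-1$, the $j$-th conjugate is $C^j(U)=u_{j+1}\cdots u_pu_1\cdots u_j$. For $n>2k-1$ define the word $V^{(k)}_n$ by: $V^{(k)}_n=W^{(k)}_{n-2k}W^{(k)}_{n-2k-1}\cdots W^{(k)}_{0}$ if $2k-1<n<3k-2$, and $V^{(k)}_n=W^{(k)}_{n-2k}W^{(k)}_{n-2k-1}\cdots W^{(k)}_{n-3k+3}$ if $n\geq 3k-2$; for $n=2k-1$ let $V^{(k)}_{2k-1}$ be the empty word. *)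

(* Defs.v *)
(* Finite words over nat are sequences [seq nat], infinite words are functions
   [nat -> nat].  The library is MathComp. *)
From mathcomp Require Import all_boot.

Set Implicit Arguments.
Unset Strict Implicit.
Unset Printing Implicit Defensive.

(* The letter a = k i + j, with 0 <= j < k, has i = a %/ k and j = a %% k. *)
Definition phi_digit (k a : nat) : seq nat :=
  if a %% k <= k - 2 then [:: k * (a %/ k); a.+1] else [:: a.+1].

Definition phi (k : nat) (U : seq nat) : seq nat :=
  flatten [seq phi_digit k a | a <- U].

Definition W (k n : nat) : seq nat := iter n (phi k) [:: 0].

(* The infinite word phi_k^omega(0), the limit of the W k n: as n < size (W k n)
   and the W k n are prefixes of each other, its m-th digit can be read in
   W k m (lemma [W_omegaE] below). *)
Definition W_omega (k : nat) : nat -> nat := fun m => nth 0 (W k m) m.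

Definition factor (U : seq nat) (w : nat -> nat) : Prop :=
  exists p, U = [seq w (p + t) | t <- iota 0 (size U)].

Definition oplus (m : nat) (U : seq nat) : seq nat := [seq m + a | a <- U].

(* W_hi W_(hi-1) ... W_lo *)
Definition W_down (k hi lo : nat) : seq nat :=
  flatten [seq W k t | t <- rev (index_iota lo hi.+1)].

(* Only meaningful for n >= 2k-1. The index n-3k+3 is written n - (3k-3), as
   subtraction on nat is truncated. *)
Definition V (k n : nat) : seq nat :=
  if n <= 2 * k - 1 then [::]
  else if n < 3 * k - 2 then W_down k (n - 2 * k) 0
  else W_down k (n - 2 * k) (n - (3 * k - 3)).

Lemma phi_cat k U U' : phi k (U ++ U') = phi k U ++ phi k U'.
Proof. by rewrite /phi map_cat flatten_cat. Qed.

Lemma size_phi k U : size U <= size (phi k U).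
Proof.
elim: U => //= a U IHU; rewrite /phi /= size_cat -/(phi k U).
by rewrite -add1n leq_add // /phi_digit; case: ifP.
Qed.

Lemma W_next k n : 1 < k ->
  exists2 U, W k n.+1 = W k n ++ U & 0 < size U.
Proof.
move=> k_gt1; elim: n => [|n [U WE U0]].
  exists [:: 1] => //=; rewrite /phi /= /phi_digit mod0n div0n muln0 leq0n.
  by [].
exists (phi k U); last exact: leq_trans (size_phi k U).
by rewrite {1}/W iterS -/(W k n.+1) {1}WE phi_cat.
Qed.

Lemma size_W k n : 1 < k -> n < size (W k n).
Proof.
move=> k_gt1; elim: n => // n IHn; have [U -> U0] := W_next n k_gt1.
by rewrite size_cat -[n.+2]addn1 leq_add.
Qed.

Lemma W_prefix k m n : 1 < k -> m <= n -> prefix (W k m) (W k n).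
Proof.
move=> k_gt1; elim: n => [|n IHn]; first by rewrite leqn0 => /eqP->; exact: prefix_refl.
rewrite leq_eqVlt => /predU1P[->|/IHn /prefix_trans]; first exact: prefix_refl.
by apply; have [U -> _] := W_next n k_gt1; exact: prefix_prefix.
Qed.

Lemma W_omegaE k n m : 1 < k -> m < size (W k n) ->
  W_omega k m = nth 0 (W k n) m.
Proof.
move=> k_gt1 ltm; rewrite /W_omega; have ltm' := size_W m k_gt1.
by have [le|/ltnW le] := leqP m n; have /prefixP[U ->] := W_prefix k_gt1 le;
   rewrite nth_cat ?ltm ?ltm'.
Qed.

(* Main.v *)
Require Import Defs.
From mathcomp Require Import all_boot.
From mathcomp Require Import zify.

(* If ab is a factor of W and k does not divide b, then a = k (b / k); if k
   divides b, then b < a + k.  The letters divisible by k mark the beginnings of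
   the blocks of phi, so a square AA followed by a letter x pulls back, possibly
   after rotating A by one letter, to a square BB with A = phi(B), unless A is a
   single letter ki: the only obstruction is a factor B c B y, where phi(c) and
   phi(y) start with the same letter and have lengths 1 and 2, and the adjacency
   condition excludes it.  Descending along W_n, every square is thus reached
   from (ki)(ki), which is followed by ki + 1.  The run generated by
   phi^m((ki)(ki)) is ki + W_m W_m V_n with n = m + 2k - 1; it is followed by
   ki + min(m + 1, k), and keeping track of this letter bounds the rotation. *)

Section PhiWords.

Local Set Implicit Arguments.
Local Unset Strict Implicit.
Local Unset Printing Implicit Defensive.

Variable k : nat.
Hypothesis k_ge3 : 3 <= k.

Let k_gt0 : 0 < k. Proof. exact: leq_trans k_ge3. Qed.
Let k_gt1 : 1 < k. Proof. exact: leq_trans k_ge3. Qed.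
Hint Resolve k_gt0 k_gt1 : core.

(** * Blocks of [phi k] and injectivity *)

Variant phi_digit_spec a : seq nat -> Type :=
| PhiDigitPair of ~~ (k %| a.+1) & a.+1 %/ k = a %/ k :
    phi_digit_spec a [:: k * (a %/ k); a.+1]
| PhiDigitSingle of k %| a.+1 & ~~ (k %| a) & a.+1 = k * (a %/ k) + k :
    phi_digit_spec a [:: a.+1].

Lemma phi_digitP a : phi_digit_spec a (phi_digit k a).
Proof.
have lt := ltn_pmod a k_gt0; have eqa := divn_eq a k.
rewrite /phi_digit; case: ifP => le.
  have eqS : a.+1 = a %/ k * k + (a %% k).+1 by rewrite {1}eqa addnS.
  have ltS : (a %% k).+1 < k by lia.
  apply: PhiDigitPair; last by rewrite eqS divnMDl // (divn_small ltS) addn0.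
  by rewrite /dvdn eqS modnMDl modn_small.
have eqS : a.+1 = k * (a %/ k) + k by nia.
apply: PhiDigitSingle => //; first by rewrite eqS dvdn_addr ?dvdn_mulr.
by rewrite /dvdn; lia.
Qed.

Lemma phi_cons a U : phi k (a :: U) = phi_digit k a ++ phi k U.
Proof. by []. Qed.

Lemma phi1 a : phi k [:: a] = phi_digit k a.
Proof. by rewrite /phi /= cats0. Qed.

Lemma phi_digit_rcons a : exists P, phi_digit k a = rcons P a.+1.
Proof. by case: phi_digitP => *; [exists [:: k * (a %/ k)] | exists [::]]. Qed.

Lemma phi_eq0 U : phi k U = [::] -> U = [::].
Proof. by case: U => // a U; rewrite phi_cons; case: phi_digitP. Qed.

Lemma dvd_head_phi_digit a c U : phi_digit k a = c :: U -> k %| c.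
Proof. by case: phi_digitP => [_ _|dv _ _] [<- _] //; exact: dvdn_mulr. Qed.

Lemma dvd_head_phi U c U' : phi k U = c :: U' -> k %| c.
Proof.
case: U => // a U; rewrite phi_cons.
by case E: (phi_digit k a) (@dvd_head_phi_digit a) => [|d T];
   [case: phi_digitP E | move=> /(_ _ _ erefl) ? [<-]].
Qed.

(** The last letter of an image is the successor of the last letter of its preimage, so preimages
    are read off from the right. *)
Lemma phi_inj : injective (phi k).
Proof.
elim/last_ind => [U'|U a IHU U']; first by move=> /esym /phi_eq0.
case: (lastP U') => [/phi_eq0 //|{}U' a'].
rewrite -!cats1 !phi_cat !phi1 => E.
have eqa : a = a'.
  move: E; have [P ->] := phi_digit_rcons a; have [P' ->] := phi_digit_rcons a'.
  by rewrite -!rcons_cat => /rcons_inj [_ ->].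
rewrite eqa in E *.
have /addIn szE : size (phi k U) + size (phi_digit k a') =
    size (phi k U') + size (phi_digit k a').
  by rewrite -!size_cat E.
by move/eqP: E; rewrite eqseq_cat // => /andP [/eqP /IHU ->].
Qed.

(* A block of [phi k] starts exactly at the letters divisible by [k]. *)
Lemma phi_cut T P c S : phi k T = P ++ c :: S -> k %| c ->
  exists T1 T2, [/\ T = T1 ++ T2, phi k T1 = P & phi k T2 = c :: S].
Proof.
move=> E dvc; elim: T P E => [|a T IHT] [|p P] //= E.
- by exists [::], (a :: T).
move: E; rewrite phi_cons; case Da: (phi_digit k a) / phi_digitP => [ndv _|_ _ _] /=.
- case: P => [|p' P] [<-].
    by move=> Ec; rewrite -Ec (negPf ndv) in dvc.
  move=> <- /IHT [T1 [T2 [-> <- <-]]]; exists (a :: T1), T2.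
  by rewrite phi_cons Da.
- case=> <- /IHT [T1 [T2 [-> <- <-]]]; exists (a :: T1), T2.
  by rewrite phi_cons Da.
Qed.

(** * Adjacent letters and desubstitution in [W k n] *)

Definition adj a b := if k %| b then b < a + k else a == k * (b %/ k).

(** After the block of [a], which ends in [a.+1], the block of [b] starts with [b] if [k] divides
    [b], and otherwise with [a] or [a + k]. *)
Lemma phi_sorted_adj U : sorted adj U -> sorted adj (phi k U).
Proof.
case: U => // a U; elim: U a => [|b U IHU] a.
  by move=> _; rewrite phi1; case: phi_digitP => //= ndv E; rewrite /adj (negPf ndv) E eqxx.
move=> /= /andP [ab /IHU sU]; rewrite phi_cons.
have hd : exists c S, [/\ phi k (b :: U) = c :: S, k %| c & c < a.+1 + k].
  rewrite phi_cons; move: ab; rewrite /adj.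
  case: (phi_digitP b) => [ndv E|dv ndv E] ab /=.
    exists (k * (b %/ k)), (b.+1 :: phi k U); split=> //; first exact: dvdn_mulr.
    case: ifP ab => [dvb|_ /eqP <-]; first by rewrite mulnC divnK // addSn ltnS => /ltnW.
    by rewrite addSn ltnS leq_addr.
  exists b.+1, (phi k U); split=> //.
  by move: ab; rewrite (negPf ndv) => /eqP ->; rewrite E addSn.
have [c [S [Ec dvc ltc]]] := hd; rewrite Ec in sU *.
have ac : adj a.+1 c by rewrite /adj dvc.
case: phi_digitP => [ndv E|_ _ _] /=; rewrite ac //=.
by rewrite {1}/adj (negPf ndv) E eqxx.
Qed.

Lemma sorted_adj_W n : sorted adj (W k n).
Proof. by elim: n => //= n; apply: phi_sorted_adj. Qed.

(** [B'] runs to the end of [W k n], so [y :: S] may stop inside a block. For empty [U], the default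
    head [0] satisfies the divisibility condition. *)
Lemma infix_phi_cut n U y S :
  infix (U ++ y :: S) (W k n.+1) -> k %| y -> k %| head 0 U ->
  exists B B', [/\ infix (B ++ B') (W k n), phi k B = U
    & exists S', phi k B' = y :: S ++ S'].
Proof.
move=> /infixP [P [Q WE]] dvy dvU.
have WE' : phi k (W k n) = P ++ (U ++ y :: S ++ Q).
  by move: WE; rewrite -catA => <-.
have [T1 [T2 [WT _ ET2]]] : exists T1 T2, [/\ W k n = T1 ++ T2,
    phi k T1 = P & phi k T2 = U ++ y :: S ++ Q].
  by case: U dvU WE' {WE} => [_|c U dvc] /phi_cut; apply.
have [B [B' [TE BE BE']]] := phi_cut ET2 dvy.
exists B, B'; split=> //; last by exists Q.
by rewrite WT TE suffix_infix.
Qed.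

(** * Shifts, concatenations and rotations under [phi k] *)

Lemma oplus_cat m U U' : oplus m (U ++ U') = oplus m U ++ oplus m U'.
Proof. exact: map_cat. Qed.

Lemma phi_oplus i U : phi k (oplus (k * i) U) = oplus (k * i) (phi k U).
Proof.
elim: U => //= a U IHU; rewrite !phi_cons oplus_cat IHU; congr (_ ++ _).
rewrite /phi_digit (mulnC k i) modnMDl divnMDl // mulnDr (mulnC k i).
by case: ifP => _; rewrite /= -addnS.
Qed.

Lemma iter_phi_oplus n i U :
  iter n (phi k) (oplus (k * i) U) = oplus (k * i) (iter n (phi k) U).
Proof. by elim: n => //= n ->; rewrite phi_oplus. Qed.

Lemma iter_phi_cat n U U' :
  iter n (phi k) (U ++ U') = iter n (phi k) U ++ iter n (phi k) U'.
Proof. by elim: n => //= n ->; rewrite phi_cat. Qed.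

Lemma phi_rot j U : phi k (rot j U) = rot (size (phi k (take j U))) (phi k U).
Proof.
by rewrite {1}/rot phi_cat -{4}(cat_take_drop j U) phi_cat rot_size_cat.
Qed.

Lemma iter_phi_rcons n a : exists P, iter n (phi k) [:: a] = rcons P (a + n).
Proof.
elim: n => [|n [P E]]; first by exists [::]; rewrite addn0.
have [P' E'] := phi_digit_rcons (a + n).
exists (phi k P ++ P').
by rewrite iterS E -cats1 phi_cat phi1 E' -rcons_cat addnS.
Qed.

(** * The word [tail m], a common prefix of [W k m] and of the image of [1] *)

(* In contrast to [V], the truncated [m - (k - 2)] handles all [m] at once. *)
Definition tail m := flatten [seq W k t | t <- rev (index_iota (m - (k - 2)) m)].

Lemma V_tail m : V k (m + (2 * k - 1)) = tail m.
Proof.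
rewrite /V /tail /W_down; case: m => [|m].
  by rewrite leqnn.
rewrite addSn leqNgt ltnS leq_addl /=.
have -> : (m + (2 * k - 1)).+1 - 2 * k = m by lia.
case: ifP => lt; last by have -> : (m + (2 * k - 1)).+1 - (3 * k - 3) = m.+1 - (k - 2) by lia.
by have -> : m.+1 - (k - 2) = 0 by lia.
Qed.

(** [phi k] raises every index by one; while there are fewer than [k - 2] factors, a new [W k 0] is
    appended. *)
Lemma tailS m :
  tail m.+1 = phi k (tail m) ++ (if m < k - 2 then [:: 0] else [::]).
Proof.
have phiE s : phi k (flatten [seq W k t | t <- s]) = flatten [seq W k t | t <- [seq t.+1 | t <- s]].
  by elim: s => //= t s <-; rewrite phi_cat.
have iotaE l : [seq t.+1 | t <- rev (index_iota l m)] = rev (index_iota l.+1 m.+1).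
  by rewrite map_rev /index_iota subSS -[l.+1]add1n iotaDl.
rewrite /tail phiE iotaE; case: ifP => lt.
  have -> : m.+1 - (k - 2) = 0 by lia.
  have -> : m - (k - 2) = 0 by lia.
  have -> : index_iota 0 m.+1 = 0 :: index_iota 1 m.+1.
    by rewrite /index_iota subn0 subSS subn0.
  by rewrite rev_cons -cats1 map_cat flatten_cat.
by rewrite cats0 subSn // leqNgt lt.
Qed.

Lemma phi_digit_small a : a <= k - 2 -> phi_digit k a = [:: 0; a.+1].
Proof.
move=> le; have lt : a < k by lia.
by rewrite /phi_digit (modn_small lt) le (divn_small lt) muln0.
Qed.

(** As long as the last letter is at most [k - 2], each step splits off a [0], which grows into a
    factor of [tail m]. *)
Lemma iter_phi_tail m e : e <= 1 ->
  iter m (phi k) [:: e] =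
  tail m ++ iter (m - (k - 2)) (phi k) [:: minn m (k - 2) + e].
Proof.
move=> le_e1; elim: m => [|m IHm]; first by rewrite /tail sub0n min0n.
rewrite iterS IHm phi_cat tailS -catA; congr (_ ++ _).
case: ltnP => lt.
  have -> : m - (k - 2) = 0 by lia.
  have -> : m.+1 - (k - 2) = 0 by lia.
  rewrite (minn_idPl lt) phi1 phi_digit_small //; lia.
by rewrite cat0s -iterS subSn // (minn_idPr (leqW lt)).
Qed.

Lemma W_tail m :
  W k m = tail m ++ iter (m - (k - 2)) (phi k) [:: minn m (k - 2)].
Proof. by rewrite /W iter_phi_tail // addn0. Qed.

Lemma size_tailW m : size (tail m) <= size (W k m).
Proof. by rewrite W_tail size_cat leq_addr. Qed.

Lemma phi_digit_oplus i a : phi_digit k (k * i + a) = oplus (k * i) (phi_digit k a).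
Proof. by rewrite -!phi1 -phi_oplus. Qed.

(** [e] is [k.-1] or [k], and both images start with the same multiple of [k]; hence the cap at [k]
    for the letter after a run. *)
Lemma head_phi_digit_wrap i e x S : k - 2 < e <= k ->
  phi_digit k (k * i + e) = x :: S -> x = k * i + k.
Proof.
move=> /andP [gt le]; rewrite phi_digit_oplus.
have [->|ne] := eqVneq e k.
  by rewrite /phi_digit modnn divnn k_gt0 muln1 /= => -[<-].
have lt : e < k by rewrite ltn_neqAle ne.
rewrite /phi_digit (modn_small lt) leqNgt gt /= => -[<- _].
by congr (_ + _); lia.
Qed.

(** * Lifting squares in runs along [phi k] *)

(* [x] is the letter following an occurrence of [A ++ A]; it matters only when
   [A ++ A] is a suffix of its run. *)
Definition square_in_run A x := exists i m j,
  [/\ 0 < i, j <= size (tail m), A = oplus (k * i) (rot j (W k m))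
    & j = size (tail m) -> x = k * i + minn m.+1 k].

Lemma take_tail m j : j <= size (tail m) -> take j (W k m) = take j (tail m).
Proof. by move=> le; rewrite W_tail takel_cat. Qed.

Lemma size_phi_take m j d R : drop j (tail m) = d :: R ->
  size (phi k (take j (tail m))) + size (phi_digit k d) <= size (phi k (tail m)).
Proof.
move=> E; rewrite -{2}(cat_take_drop j (tail m)) E phi_cat phi_cons !size_cat.
by rewrite addnA leq_addr.
Qed.

Lemma drop_cons (T : Type) (s : seq T) j : j < size s -> exists d R, drop j s = d :: R.
Proof.
case: (drop j s) (size_drop j s) => [/esym /eqP|d R _ _]; last by exists d, R.
by rewrite subn_eq0 leqNgt => /negPf ->.
Qed.

Lemma square_in_run_phi B y x S : phi_digit k y = x :: S ->
  square_in_run B y -> square_in_run (phi k B) x.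
Proof.
move=> Dy [i [m [j [i_gt0 lej -> yE]]]].
exists i, m.+1, (size (phi k (take j (tail m)))); split=> //.
- rewrite tailS size_cat.
  apply: leq_trans (leq_addr _ _).
  by rewrite -{2}(cat_take_drop j (tail m)) phi_cat size_cat leq_addr.
- by rewrite phi_oplus phi_rot take_tail.
rewrite tailS size_cat => szE.
(* The new offset reaches the end of [tail m.+1] only if [j] was already maximal and [tailS] adds no
   [0]. *)
have [ltj|gej] := ltnP j (size (tail m)).
  have [d [R dE]] := drop_cons ltj; have := size_phi_take dE.
  by case: phi_digitP => /=; lia.
have jE : j = size (tail m) by apply/eqP; rewrite eqn_leq lej.
move: szE; rewrite jE take_size; case: ltnP => [_ /=|gem _]; first by lia.
have -> : minn m.+2 k = k by lia.
by move: Dy; rewrite (yE jE); apply: head_phi_digit_wrap; lia.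
Qed.

Lemma head_W n : exists U, W k n = 0 :: U.
Proof. by have /prefixP [U ->] := W_prefix k_gt1 (leq0n n); exists U. Qed.

Lemma square_in_run_shift B y l c A x S S' : ~~ (k %| c) ->
  phi k B = l :: c :: A -> phi k (y :: S) = l :: x :: S' ->
  square_in_run B y -> square_in_run (c :: rcons A l) x.
Proof.
move=> ndc BE yE [i [m [j [i_gt0 lej BE' yE']]]].
pose j' := size (phi k (take j (tail m))).
have A1E : l :: c :: A = oplus (k * i) (rot j' (W k m.+1)).
  by rewrite -BE BE' phi_oplus phi_rot take_tail.
have AE : j' < size (W k m.+1) ->
    c :: rcons A l = oplus (k * i) (rot j'.+1 (W k m.+1)).
  by move=> lt; rewrite rotS // /oplus map_rot -[map _ _]A1E rot1_cons.
have [ltj|gej] := ltnP j (size (tail m)).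
  have [d [R dE]] := drop_cons ltj.
  (* The image of [d] begins with the shifted-back [l] and [c]. As [c] starts no block, this image
     has two letters, and the extra rotation passes only the first. *)
  have lt : j'.+1 < size (tail m.+1).
    have := size_phi_take dE; rewrite tailS size_cat -/j'.
    suff -> : size (phi_digit k d) = 2 by lia.
    have [R' RE] : exists R', rot j (W k m) = d :: R'.
      rewrite /rot {1}W_tail drop_cat ltj dE.
      set Z := iter _ _ _.
      by exists (R ++ Z ++ take j (W k m)); rewrite /= catA.
    move: BE; rewrite BE' RE phi_oplus phi_cons.
    case: phi_digitP => //= _ _ _ [_ +].
    case E : (phi k R') => [|e U] //= [ce _].
    by move: ndc; rewrite -ce dvdn_addr ?dvdn_mulr // (dvd_head_phi E).
  exists i, m.+1, j'.+1; split=> //; first exact: ltnW.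
  - by apply: AE; apply: leq_trans (size_tailW _); apply: ltnW.
  - by lia.
have jE : j = size (tail m) by apply/eqP; rewrite eqn_leq lej.
(* For [m < k - 2] the new [0] of [tail m.+1] makes room for the extra rotation. Otherwise [l] would
   be both [k * i] and [k * i + k]. *)
move: yE; rewrite phi_cons (yE' jE); have [ltm|gem] := ltnP m (k - 2).
  have -> : minn m.+1 k = m.+1 by lia.
  rewrite phi_digit_oplus phi_digit_small //= => -[lE xE _].
  have szE : j'.+1 = size (tail m.+1).
    by rewrite tailS ltm size_cat addn1 /j' jE take_size.
  exists i, m.+1, j'.+1; split=> //; first by rewrite szE.
  - by apply: AE; rewrite szE; apply: size_tailW.
  - by move=> _; rewrite -xE; lia.
case E : (phi_digit _ _) => [|l' U]; first by case: phi_digitP E.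
move=> /= [El _ ]; have := @head_phi_digit_wrap i (minn m.+1 k) l' U.
rewrite E => /(_ _ erefl) l'E.
have lE : l = k * i + 0.
  move: A1E; rewrite /j' jE take_size W_tail (minn_idPr (leqW gem)) tailS.
  rewrite [m < _]ltnNge gem cats0 rot_size_cat subSn // iterSr phi1.
  rewrite phi_digit_small // (iter_phi_cat _ [:: 0]) -/(W k _).
  by have [U' ->] := head_W (m - (k - 2)) => -[].
have : l' = k * i + k by apply: l'E; lia.
lia.
Qed.

(** * Descent of squares along [W k n] *)

Lemma phi_eq1 B c : phi k B = [:: c] -> exists b,
  [/\ B = [:: b], b.+1 = c, ~~ (k %| b) & c = k * (b %/ k) + k].
Proof.
case: B => // b B; rewrite phi_cons; case: phi_digitP => //= _ ndv E [bc].
by move=> /phi_eq0 ->; exists b; rewrite -bc.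
Qed.

Lemma phi_cons_pair y B l x S : phi k (y :: B) = l :: x :: S -> ~~ (k %| x) ->
  y.+1 = x /\ l = k * (y %/ k).
Proof.
rewrite phi_cons; case: phi_digitP => /= [_ _|_ _ _]; first by case=> <- <-.
by case=> _ /dvd_head_phi ->.
Qed.

(* A letter cannot be followed both by a letter that [phi k] sends to the single
   letter [c.+1] and by one whose image starts with [c.+1] and has size 2. *)
Lemma adj_single_pair b c y : ~~ (k %| c) -> c.+1 = k * (c %/ k) + k ->
  c.+1 = k * (y %/ k) -> adj b c -> ~ adj b y.
Proof.
rewrite /adj => ndc cE yE; rewrite (negPf ndc) => /eqP bE.
case: ifP => [dvy|_ /eqP bE']; last by lia.
have : k * (y %/ k) = y by rewrite mulnC divnK.
lia.
Qed.

Lemma square_in_W n A x : A <> [::] -> infix (A ++ A ++ [:: x]) (W k n) ->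
  square_in_run A x.
Proof.
elim: n A x => [|n IHn] [|c A] x // _ AAx.
  by have /= := size_infix AAx; rewrite !size_cat /=; lia.
have [dvc|ndc] := boolP (k %| c).
  (* If [c] and [x] both start blocks, the square is the image of a square. *)
  have [dvx|ndx] := boolP (k %| x).
    have [] := @infix_phi_cut n ((c :: A) ++ c :: A) x [::] => //.
      by rewrite -catA.
    move=> B [[|y B'] [BB BE [S' yE]]] //.
    have [B1 [B2 [EB BE1 BE2]]] := phi_cut BE dvc.
    have E12 : B1 = B2 by apply: phi_inj; rewrite BE1.
    have [S yS] : exists S, phi_digit k y = x :: S.
      move: yE; rewrite phi_cons; case: (phi_digit k y) (phi_digit_rcons y).
        by case=> -[].
      by move=> d S _ [<- _]; exists S.
    rewrite -BE1; apply: (square_in_run_phi yS); apply: IHn.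
      by move=> B10; rewrite B10 in BE1.
    move: BB; rewrite EB -E12 -(cat1s y B') -!catA !catA; exact: catr_infix.
  case/lastP: A AAx => [|A l] AAx.
    (* The descent stops here: the first [c] is a whole block, hence at least [k], and [adj] forces
       [y = c]. This is a run with [m = 0]. *)
    have [] := @infix_phi_cut n [:: c] c [:: x] => //.
    move=> B [[|y B'] [BB /phi_eq1 [b [EB bc ndb cE]] [S' yE]]] //.
    have [yx cy] := phi_cons_pair yE ndx.
    have := infix_sorted BB (sorted_adj_W n).
    rewrite EB /= /adj => /andP [+ _]; case: ifP => [dvy ltyb|_ /eqP bE].
      have yc : y = c by rewrite cy mulnC divnK.
      exists (c %/ k), 0, 0; split=> //.
      - by rewrite divn_gt0 // cE leq_addl.
      - by rewrite rot0 /W /oplus /= addn0 mulnC divnK.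
      - by move=> _; rewrite (minn_idPl (ltnW k_gt1)) mulnC divnK // addn1 -yx yc.
    by rewrite bE dvdn_mulr in ndb.
  have {}AAx : infix (((c :: A) ++ l :: c :: A) ++ [:: l; x]) (W k n.+1).
    by move: AAx; rewrite -rcons_cons -cats1 -!catA.
  have lE : l = k * (x %/ k).
    have := infix_sorted (catl_infix AAx) (sorted_adj_W n.+1).
    by rewrite /= /adj (negPf ndx) andbT => /eqP.
  have dvl : k %| l by rewrite lE dvdn_mulr.
  (* The middle [l] is a block by itself, the last one shares its block with [x]. The preimage is
     [B1 b B1 y], with [b] and [y] both following the last letter of [B1]. *)
  have [//|//|B [[|y B'] [BB BE [S' yE]]] //] := infix_phi_cut AAx.
  have [B1 [B2 [EB BE1 BE2]]] := phi_cut BE dvl.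
  have [B3 [B4 [EB2 BE3 BE4]]] := @phi_cut B2 [:: l] c A BE2 dvc.
  have [b [EB3 bl ndb bE]] := phi_eq1 BE3.
  have E14 : B4 = B1 by apply: phi_inj; rewrite BE1.
  have [_ ly] := phi_cons_pair yE ndx.
  case/lastP: B1 => [|B1 d] in BE1 E14 EB; first by [].
  have := infix_sorted BB (sorted_adj_W n).
  rewrite EB EB2 EB3 E14 -!cats1 -!catA /= => sB.
  exfalso; apply: (@adj_single_pair d b y) => //; rewrite ?bl //.
  - by have /= /andP[] := infix_sorted (suffix_infix B1 _) sB.
  - have /infix_sorted /(_ sB) /= /andP[] // :
      infix [:: d; y] (B1 ++ [:: d, b & B1 ++ [:: d, y & B']]).
    by apply/infixP; exists (B1 ++ [:: d, b & B1]), B'; rewrite -catA.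
(* Now [c] lies inside a block, so [l] precedes each copy of the root; the root thus ends in [l],
   and the square shifts left by one letter. *)
case/infixP: AAx => [P [S WE]]; case/lastP: P => [|P l] in WE.
  by have /dvd_head_phi := WE : phi k (W k n) = _; rewrite (negPf ndc).
have lE : l = k * (c %/ k).
  have := sorted_adj_W n.+1; rewrite WE cat_rcons => /(infix_sorted (suffix_infix P _)).
  by rewrite /= {1}/adj (negPf ndc) => /andP [/eqP].
have dvl : k %| l by rewrite lE dvdn_mulr.
have adj_c l' P' S' : W k n.+1 = P' ++ [:: l', c & S'] -> l' = l.
  move=> WE'; have := sorted_adj_W n.+1; rewrite WE' => /(infix_sorted (suffix_infix P' _)).
  by rewrite /= {1}/adj (negPf ndc) -lE => /andP [/eqP].
case/lastP: A WE => [|A l'] WE.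
  have cl : c = l by apply: (adj_c c (rcons P l) (x :: S)).
  by rewrite cl dvl in ndc.
have l'l : l' = l.
  apply: (adj_c _ (rcons P l ++ c :: A) (rcons A l' ++ x :: S)).
  by rewrite WE -rcons_cons -[X in (X ++ _) ++ S]cats1 -!catA.
have {WE} Wx : infix (([:: l, c & A] ++ [:: l, c & A]) ++ [:: l; x]) (W k n.+1).
  apply/infixP; exists P, S; rewrite WE l'l -!cats1 -!catA /=.
  by rewrite -!catA.
have [//|//|B [[|y B'] [BB BE [S' yE]]] //] := infix_phi_cut Wx.
have [B1 [B2 [EB BE1 BE2]]] := @phi_cut B [:: l, c & A] l (c :: A) BE dvl.
have E12 : B1 = B2 by apply: phi_inj; rewrite BE1.
rewrite l'l; apply: (square_in_run_shift ndc BE1 yE); apply: IHn.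
  by move=> B10; rewrite B10 in BE1.
by move: BB; rewrite EB -E12 -(cat1s y B') !catA; exact: catr_infix.
Qed.

Lemma square_infixP A : A <> [::] -> (exists n, infix (A ++ A) (W k n)) ->
  exists i m j, [/\ 0 < i, j <= size (tail m) & A = oplus (k * i) (rot j (W k m))].
Proof.
move=> A0 [n /infixP [P [S WE]]].
(* Passing to [W k n.+1] provides a letter after the square. *)
have [U WE' U0] := W_next n k_gt1; rewrite WE -!catA in WE'.
have [|x [S' SE]] := @drop_cons _ (S ++ U) 0; first by rewrite size_cat addn_gt0 U0 orbT.
rewrite drop0 in SE; rewrite SE in WE'.
have [|i [m [j [? ? ? _]]]] := @square_in_W n.+1 A x A0; last by exists i, m, j.
by apply/infixP; exists P, S'; rewrite WE' -!catA.
Qed.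

(** * Occurrence of every run in some [W k n] *)

Definition in_some_W U := exists n, infix U (W k n).

Lemma in_some_W_infix U U' : infix U U' -> in_some_W U' -> in_some_W U.
Proof. by move=> UU' [n U'W]; exists n; apply: infix_trans U'W. Qed.

Lemma in_some_W_phi n U : in_some_W U -> in_some_W (iter n (phi k) U).
Proof.
move=> [m /infixP [P [S WE]]]; exists (n + m).
by rewrite /W iterD -/(W k m) WE !iter_phi_cat infix_infix.
Qed.

(** [W k k] ends in the letter [k], whose iterated images are the words [oplus k (W k n)]. *)
Lemma in_some_W_oplus i U : in_some_W U -> in_some_W (oplus (k * i) U).
Proof.
move=> UW; elim: i => [|i IHi].
  by rewrite muln0 /oplus; under eq_map do rewrite add0n; rewrite map_id.
have -> : oplus (k * i.+1) U = oplus (k * 1) (oplus (k * i) U).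
  by rewrite /oplus -map_comp; apply: eq_map => a /=; rewrite muln1 mulnS addnA.
have [n /infixP [P [S WE]]] := IHi; exists (n + k).
have [P' WkE] := iter_phi_rcons k 0.
rewrite /W iterD WkE -cats1 iter_phi_cat; apply: infix_catl.
have -> : [:: 0 + k] = oplus (k * 1) [:: 0] by rewrite /oplus /= muln1 addn0.
by rewrite iter_phi_oplus -/(W k n) WE !oplus_cat infix_infix.
Qed.

(** Up to a shift, the goal is [k k (k+1)]. Starting from [0 (k-1)], one reaches [1 k], [2 k], and
    so on up to [(k-1) k], whose image is the goal. *)
Lemma in_some_W_seed i : 0 < i -> in_some_W (oplus (k * i) [:: 0; 0; 1]).
Proof.
case: i => // i _.
have -> : oplus (k * i.+1) [:: 0; 0; 1] = oplus (k * i) [:: k; k; k.+1].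
  by rewrite /oplus /= mulnSr !addn0 addn1 addnS.
apply: in_some_W_oplus.
have phi_digit_k : phi_digit k k = [:: k; k.+1].
  by rewrite /phi_digit modnn divnn k_gt0 muln1.
have phi_digit_k1 : phi_digit k k.-1 = [:: k].
  have lt : k.-1 < k by rewrite prednK.
  by rewrite /phi_digit modn_small // ifF ?prednK //; lia.
have step1 : in_some_W [:: 0; k.-1].
  exists k.-1; have [P WE] := iter_phi_rcons (k - 2) 0.
  have -> : k.-1 = (k - 2).+1 by lia.
  by rewrite /W iterS WE -cats1 phi_cat phi1 phi_digit_small // suffix_infix.
have step2 : in_some_W [:: 1; k].
  have := in_some_W_phi 1 step1; apply: in_some_W_infix.
  by rewrite /= phi_cons phi1 phi_digit_small // phi_digit_k1 infix_cons.
have step3 j : j <= k - 2 -> in_some_W [:: j.+1; k].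
  elim: j => // j IHj lt; have := in_some_W_phi 1 (IHj (ltnW lt)).
  apply: in_some_W_infix; rewrite /= phi_cons phi1 phi_digit_small // phi_digit_k.
  by apply/infixP; exists [:: 0], [:: k.+1].
have := in_some_W_phi 1 (step3 _ (leqnn _)).
have -> : (k - 2).+1 = k.-1 by lia.
by rewrite /= phi_cons phi1 phi_digit_k1 phi_digit_k.
Qed.

Lemma in_some_W_run i m : 0 < i ->
  in_some_W (oplus (k * i) (W k m ++ W k m ++ tail m)).
Proof.
move=> i_gt0; have := in_some_W_phi m (in_some_W_seed i_gt0).
apply: in_some_W_infix; rewrite iter_phi_oplus.
rewrite (iter_phi_cat m [:: 0]) (iter_phi_cat m [:: 0] [:: 1]) (@iter_phi_tail m 1) //.
by rewrite !oplus_cat !catA prefix_infix.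
Qed.

(** The prefix [t] of length [j] is common to [W k m] and [tail m], so the run reads [t d t d t d']
    and contains [d t d t]. *)
Lemma infix_square_run j m : j <= size (tail m) ->
  infix (rot j (W k m) ++ rot j (W k m)) (W k m ++ W k m ++ tail m).
Proof.
move=> lej; have WE := esym (cat_take_drop j (W k m)).
have tE : tail m = take j (W k m) ++ drop j (tail m).
  by rewrite take_tail // cat_take_drop.
rewrite /rot.
move: (take j (W k m)) (drop j (W k m)) (drop j (tail m)) WE tE => t d d' -> ->.
by apply/infixP; exists t, d'; rewrite -!catA.
Qed.

(** * From finite words to the infinite word *)

Lemma factor_in_some_W U : factor U (W_omega k) <-> in_some_W U.
Proof.
split=> [[p UE]|[n /infixP [P [S WE]]]].
  exists (p + size U); have := size_W (p + size U) k_gt1; set w := W k _ => lt.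
  have -> : U = take (size U) (drop p w).
    rewrite {1}UE; apply: (@eq_from_nth _ 0).
      by rewrite size_map size_iota size_takel // size_drop; lia.
    move=> t; rewrite size_map size_iota => ltt.
    rewrite (nth_map 0) ?size_iota // nth_iota // add0n nth_take // nth_drop.
    by apply: W_omegaE => //; apply: leq_ltn_trans lt; lia.
  exact: infix_trans (infix_take _ _) (infix_drop _ _).
exists (size P); apply: (@eq_from_nth _ 0) => [|t ltt].
  by rewrite size_map size_iota.
rewrite (nth_map 0) ?size_iota // nth_iota // add0n (@W_omegaE k n) //; last first.
  by rewrite WE !size_cat ltn_add2l ltn_addr.
by rewrite WE nth_cat ltnNge leq_addr /= addKn nth_cat ltt.
Qed.

End PhiWords.

Theorem theorem39 (k : nat) (hk : 3 <= k) (A : seq nat) (hA : A <> [::]) :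
  factor (A ++ A) (W_omega k) <->
  exists n j i : nat,
    [/\ 2 * k - 1 <= n, j <= size (V k n), 0 < i
      & A = oplus (k * i) (rot j (W k (n - (2 * k - 1))))].
Proof.
rewrite factor_in_some_W //; split=> [/(square_infixP hk hA) [i [m [j [i0 lej ->]]]]|].
  by exists (m + (2 * k - 1)), j, i; rewrite leq_addl V_tail // addnK.
move=> [n [j [i [len lej i_gt0 ->]]]].
rewrite -oplus_cat; move: lej; rewrite -{1}(subnK len) V_tail // => lej.
apply: in_some_W_infix (in_some_W_run hk (n - (2 * k - 1)) i_gt0).
have /infixP [P [S ->]] := infix_square_run hk lej.
by rewrite !oplus_cat infix_infix.
Qed.
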